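(* Let $n\ge 2$, $1\le r<n$, $s=n-r$, let $E_1,\dots,E_n,F$ be Banach spaces over $\mathbb{K}$, let $q_1,\dots,q_s\in[1,\infty)$, and let $A\in\mathcal{L}(E_1,\dots,E_n;F)$. For $x_1\in E_1,\dots,x_r\in E_r$ let $A_{x_1\dots x_r}:E_{r+1}\times\dots\times E_n\to F$ be the $s$-linear mapping $A_{x_1\dots x_r}(x_{r+1},\dots,x_n)=A(x_1,\dots,x_n)$. Suppose that there exists $K>0$ such that for all $x_1\in E_1,\dots,x_r\in E_r$ the mapping $A_{x_1\dots x_r}$ is absolutely $(1;q_1,\dots,q_s)$-summing and $$\|A_{x_1\dots x_r}\|_{as(1;q_1,\dots,q_s)}\le K\|A\|\,\|x_1\|\cdots\|x_r\|.$$ Then $A$ is absolutely $(1;\underbrace{1,\dots,1}_{r},q_1,\dots,q_s)$-summing.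
   Context: The scalar field $\mathbb{K}$ is $\mathbb{R}$ or $\mathbb{C}$. $\mathcal{L}(E_1,\dots,E_n;F)$ is the Banach space of bounded $n$-linear mappings $E_1\times\dots\times E_n\to F$ with the sup norm $\|\cdot\|$ (supremum over products of closed unit balls). For $p\ge1$, $l_p(E)$ is the space of sequences $(x_j)$ in $E$ with $\|(x_j)\|_p=(\sum_j\|x_j\|^p)^{1/p}<\infty$, and $l_p^w(E)$ is the space of sequences $(x_j)$ in $E$ with $(\varphi(x_j))_j\in l_p$ for every bounded linear functional $\varphi$ on $E$, with $\|(x_j)\|_{w,p}=\sup_{\varphi\in B_{E'}}\|(\varphi(x_j))_j\|_p$; for finite sequences $\|\cdot\|_{w,p}$ is defined by the same formula. A mapping $T\in\mathcal{L}(E_1,\dots,E_n;F)$ is absolutely $(p;q_1,\dots,q_n)$-summing if $(T(x_j^{(1)},\dots,x_j^{(n)}))_{j=1}^\infty\in l_p(F)$ whenever $(x_j^{(i)})_{j=1}^\infty\in l_{q_i}^w(E_i)$ for $i=1,\dots,n$. Equivalently, there is $C>0$ such that $(\sum_{j=1}^k\|T(x_j^{(1)},\dots,x_j^{(n)})\|^p)^{1/p}\le C\prod_{i=1}^n\|(x_j^{(i)})_{j=1}^k\|_{w,q_i}$ for all $k\in\mathbb{N}$ and all $x_j^{(i)}\in E_i$; the infimum of such $C$ is $\|T\|_{as(p;q_1,\dots,q_n)}$. *)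

(* Defs.v *)
From HB Require Import structures.
From mathcomp Require Import all_boot all_order all_algebra.
From mathcomp Require Import all_classical all_reals all_analysis.
From mathcomp Require Import complex.

Set Implicit Arguments.
Unset Strict Implicit.
Unset Printing Implicit Defensive.

Import Order.TTheory GRing.Theory Num.Theory.
Import numFieldNormedType.Exports.

Local Open Scope classical_set_scope.
Local Open Scope ring_scope.

Variant scalar_kind := RealScalars | ComplexScalars.

Definition scalars (R : realType) (k : scalar_kind) : numFieldType :=
  match k with RealScalars => R | ComplexScalars => R[i] end.

Definition real_part (R : realType) (k : scalar_kind) : scalars R k -> R :=
  match k with
  | RealScalars => fun a => a
  | ComplexScalars => fun a => complex.Re a
  end.

(* In the library the norm of a normed module over K takes its values in K (on
   the nonnegative real axis, when K is the complex field); rnorm is the same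
   norm, valued in R. *)
Definition rnorm (R : realType) (k : scalar_kind)
    (V : normedModType (scalars R k)) (v : V) : R :=
  real_part `|v|.

Section Multilinear.
Context (R : realType) (k : scalar_kind) (n : nat).
Local Notation K := (scalars R k).
Context (E : 'I_n -> completeNormedModType K) (F : completeNormedModType K).
Implicit Type T : (forall i, E i) -> F.

(* dfwith x i u is the tuple x with its entry of index i replaced by u : E i. *)
Definition multilinear T : Prop :=
  forall (x : forall i, E i) (i : 'I_n) (a : K) (u v : E i),
    T (dfwith x i (a *: u + v)) = a *: T (dfwith x i u) + T (dfwith x i v).

Definition mlnorm T : \bar R :=
  ereal_sup [set (rnorm (T x))%:E |
              x in [set x : forall i, E i | forall i, rnorm (x i) <= 1]].

Definition bounded_multilinear T : Prop :=
  multilinear T /\ (mlnorm T < +oo)%E.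

End Multilinear.

Section Sequences.
Context (R : realType) (k : scalar_kind).
Local Notation K := (scalars R k).

Definition lp_norm (V : normedModType K) (p : R) (x : nat -> V) : \bar R :=
  ((\sum_(0 <= j <oo) (rnorm (x j) `^ p)%:E) `^ p^-1)%E.

Definition lp (V : normedModType K) (p : R) : set (nat -> V) :=
  [set x : nat -> V | (lp_norm p x < +oo)%E].

Definition lp_norm_fin (V : normedModType K) (p : R) (m : nat)
    (x : 'I_m -> V) : R :=
  (\sum_(j < m) rnorm (x j) `^ p) `^ p^-1.

Definition dual_norm (V : normedModType K) (phi : {linear V -> K^o}) : \bar R :=
  ereal_sup [set (rnorm (phi v))%:E | v in [set v : V | rnorm v <= 1]].

Definition weak_lp (V : normedModType K) (p : R) : set (nat -> V) :=
  [set x : nat -> V | forall phi : {linear V -> K^o},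
             (dual_norm phi < +oo)%E -> lp p (phi \o x)].

Definition weak_norm_fin (V : normedModType K) (p : R) (m : nat)
    (x : 'I_m -> V) : \bar R :=
  ereal_sup [set (lp_norm_fin p (phi \o x))%:E |
              phi in [set phi : {linear V -> K^o} | (dual_norm phi <= 1)%E]].

End Sequences.

Section Summing.
Context (R : realType) (k : scalar_kind) (n : nat).
Local Notation K := (scalars R k).
Context (E : 'I_n -> completeNormedModType K) (F : completeNormedModType K).

Definition absolutely_summing (p : R) (q : 'I_n -> R)
    (T : (forall i, E i) -> F) : Prop :=
  forall x : (forall i, nat -> E i),
    (forall i, weak_lp (q i) (x i)) -> lp p (fun j => T (fun i => x i j)).

Definition summing_constant (p : R) (q : 'I_n -> R) (T : (forall i, E i) -> F)
    (C : R) : Prop :=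
  forall (m : nat) (x : forall i, 'I_m -> E i),
    ((lp_norm_fin p (fun j => T (fun i => x i j)))%:E
       <= C%:E * \prod_(i < n) weak_norm_fin (q i) (x i))%E.

(* The infimum is +oo when T has no summing constant. *)
Definition as_norm (p : R) (q : 'I_n -> R) (T : (forall i, E i) -> F) : \bar R :=
  ereal_inf [set C%:E | C in [set C : R | 0 < C /\ summing_constant p q T C]].

End Summing.

Section Partial.
Context (r s : nat).

(* The tuple (x_1, ..., x_r, y_1, ..., y_s). *)
Definition append (E : 'I_(r + s) -> Type) (x : forall i, E (lshift s i))
    (y : forall j, E (rshift r j)) (l : 'I_(r + s)) : E l :=
  match split_ordP l with
  | SplitOrdLo i e => ecast l (E l) (esym e) (x i)
  | SplitOrdHi j e => ecast l (E l) (esym e) (y j)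
  end.

Lemma append_lshift (E : 'I_(r + s) -> Type) x y i :
  @append E x y (lshift s i) = x i.
Proof.
rewrite /append; case: split_ordP => j e; last first.
  by move/eqP: (e); rewrite eq_shift.
by have ij := lshift_inj e; subst j; rewrite (eq_axiomK e).
Qed.

Lemma append_rshift (E : 'I_(r + s) -> Type) x y j :
  @append E x y (rshift r j) = y j.
Proof.
rewrite /append; case: split_ordP => i e.
  by move/eqP: (e); rewrite eq_shift.
by have ij := rshift_inj e; subst i; rewrite (eq_axiomK e).
Qed.

(* The s-linear mapping A_{x_1...x_r}. *)
Definition fix_first (E : 'I_(r + s) -> Type) (F : Type)
    (A : (forall l, E l) -> F) (x : forall i, E (lshift s i)) :
    (forall j, E (rshift r j)) -> F :=
  fun y => A (append x y).

(* The exponents (1, ..., 1, q_1, ..., q_s), with 1 repeated r times. *)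
Definition ones_then (R : realType) (q : 'I_s -> R) : 'I_(r + s) -> R :=
  append (E := fun=> R) (fun=> 1) q.

End Partial.

(* Main.v *)
From HB Require Import structures.
Require Import Defs.
From mathcomp Require Import all_boot all_order all_algebra.
From mathcomp Require Import all_classical all_reals all_analysis.
From mathcomp Require Import complex ring lra.

Set Implicit Arguments.
Unset Strict Implicit.
Unset Printing Implicit Defensive.

Import Order.TTheory GRing.Theory Num.Theory.
Import numFieldNormedType.Exports.

Local Open Scope ring_scope.

(** The theorem is the case r = 1 applied to one variable at a time.  Write
    y_j for the last s entries of the j-th tuple.  With the first r variables
    frozen at arbitrary vectors, the hypothesis says that the sum over j of the
    norms of A (z_1, ..., z_r, y_j) is finite.  The frozen variables are then
    replaced, from left to right, by the sequences x_j^(1), ..., x_j^(r); each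
    replacement is an instance of [diagonal_summable]: if h_0, h_1, ... are
    continuous seminorms on a Banach space such that the sum of the h_j (v) is
    finite for every v, and if x is weakly 1-summable, then the sum of the
    h_j (x_j) is finite.

    The latter holds for three reasons.  By uniform boundedness the sum of the
    h_j (v) is at most a multiple of the norm of v.  For a weakly 1-summable
    sequence the signed sums of x_0, ..., x_(m-1), with arbitrary signs, are
    bounded independently of m ([weak_l1_signed_sum_bounded]): uniform
    boundedness on the dual bounds the sum of the |f (x_l)| for f in the unit
    ball, and a norming functional (Hahn-Banach) turns this into a bound of
    norms.  Finally, averaging over signs, as in the theory of Rademacher
    functions, bounds the sum of the h_j (x_j) by the largest value of the sum
    of the h_j at a signed sum ([sum_diagonal_le]).

    The duality arguments are made with real-linear functionals only, whatever
    the scalars are: a bounded real-linear functional is dominated by a linear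
    one ([real_part_functional]). *)

(** * Norming functionals on a real vector space *)

Section Sublinear.
Context (R : realType) (V : lmodType R).
Implicit Types (q : V -> R) (u v w : V).

(** The homogeneity is stated as an inequality because this is all that an
    infimum of sublinear functions has to satisfy; equality follows by applying
    the inequality to t and to its inverse. *)
Definition sublinear q : Prop :=
  (forall u v, q (u + v) <= q u + q v) /\
  (forall t v, 0 < t -> q (t *: v) <= t * q v).

Lemma sublinearZ q t v : sublinear q -> 0 < t -> q (t *: v) = t * q v.
Proof.
move=> [_ qZ] t0; apply/le_anti/andP; split; first exact: qZ.
have := qZ t^-1 (t *: v); rewrite invr_gt0 => /(_ t0).
by rewrite scalerA mulVf ?gt_eqF// scale1r ler_pdivlMl.
Qed.

Lemma sublinear0 q : sublinear q -> q 0 = 0.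
Proof.
move=> sq; have := @sublinearZ q 2 0 sq ltac:(lra).
by rewrite scaler0 => /eqP; lra.
Qed.

Lemma sublinearN q v : sublinear q -> - q (- v) <= q v.
Proof.
by move=> sq; have := sq.1 v (- v); rewrite subrr (sublinear0 sq); lra.
Qed.

(** The largest sublinear function below q whose value at - u is at most
    - q u.  It serves twice: a minimal q is equal to it, which forces q to be
    additive, and applied to a norm it gives a sublinear function such that
    every linear function below it takes the value of the norm at u. *)
Definition tilt q u v : R := inf [set q (v + t *: u) - t * q u | t in [set t | 0 <= t]].

Lemma tilt_has_lbound q u v : sublinear q ->
  has_lbound [set q (v + t *: u) - t * q u | t in [set t | 0 <= t]].
Proof.
move=> sq; exists (- q (- v)) => _ [t /= t0 <-].
have := sq.1 (v + t *: u) (- v); rewrite addrC addKr.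
have [->|tn0] := eqVneq t 0; first by rewrite scale0r (sublinear0 sq); lra.
by rewrite (sublinearZ _ sq) ?lt_def ?tn0//; lra.
Qed.

Lemma tilt_le q u v t : sublinear q -> 0 <= t ->
  tilt q u v <= q (v + t *: u) - t * q u.
Proof. by move=> sq t0; apply: ge_inf; [exact: tilt_has_lbound|exists t]. Qed.

Lemma tilt_ge q u v c : (forall t, 0 <= t -> c <= q (v + t *: u) - t * q u) ->
  c <= tilt q u v.
Proof.
move=> cq; apply: lb_le_inf => [|_ [t /= t0 <-]]; last exact: cq.
by eexists; exists 0 => //=.
Qed.

Lemma tilt_le_self q u v : sublinear q -> tilt q u v <= q v.
Proof.
by move=> sq; have := tilt_le u v sq (lexx 0); rewrite scale0r mul0r addr0 subr0.
Qed.

Lemma sublinear_tilt q u : sublinear q -> sublinear (tilt q u).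
Proof.
move=> sq; split=> [v w|t v t0].
- rewrite -lerBlDl; apply: tilt_ge => s s0.
  rewrite lerBlDl -lerBlDr; apply: tilt_ge => t t0.
  have := tilt_le u (v + w) sq (addr_ge0 s0 t0).
  have := sq.1 (w + s *: u) (v + t *: u).
  by rewrite addrACA (addrC w) -scalerDl; lra.
- rewrite -ler_pdivrMl//; apply: tilt_ge => s s0.
  have := tilt_le u (t *: v) sq (mulr_ge0 (ltW t0) s0).
  by rewrite -scalerA -scalerDr (sublinearZ _ sq)// ler_pdivrMl//; lra.
Qed.

Definition below q q' : Prop := forall v, q v <= q' v.

(** Zorn's lemma downwards: the pointwise infimum of a chain of sublinear
    functions is again sublinear, since two values of the chain at different
    points are dominated by values of a single member. *)
Lemma minimal_sublinear q : sublinear q ->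
  exists m, [/\ sublinear m, below m q &
    forall m', sublinear m' -> below m' m -> m' = m].
Proof.
move=> sq.
pose T := {m : V -> R | sublinear m /\ below m q}.
pose le (a b : T) := `[< below (sval b) (sval a) >].
have [|||C totC|m mmin] := @Zorn T le.
- by move=> t; apply/asboolP => v.
- move=> a b c /asboolP ab /asboolP bc; apply/asboolP => v.
  exact: le_trans (bc v) (ab v).
- move=> [a aP] [b bP] /asboolP /= ab /asboolP /= ba.
  by apply: eq_exist; apply/funext => v; apply/le_anti; rewrite ab ba.
- have [[a0 Ca0]|C0] := pselect (exists a, C a); last first.
    have qq : sublinear q /\ below q q by split.
    by exists (exist _ q qq) => s Cs; case: C0; exists s.
  pose i v := inf [set sval a v | a in C].
  have i_le a v : C a -> i v <= sval a v.
    move=> Ca; apply: ge_inf; last by exists a.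
    exists (- q (- v)) => _ [[b [sb bq]] _ <-] /=.
    by have := sublinearN v sb; have := bq (- v); lra.
  have i_ge v c : (forall a, C a -> c <= sval a v) -> c <= i v.
    move=> ca; apply: lb_le_inf => [|_ [a Ca <-]]; last exact: ca.
    by eexists; exists a0.
  have si : sublinear i.
    split=> [v w|t v t0].
    - rewrite -lerBlDl; apply: (@i_ge) => a Ca.
      rewrite lerBlDl -lerBlDr; apply: (@i_ge) => b Cb.
      have [/asboolP ab|/asboolP ba] := totC _ _ Ca Cb.
      + have := i_le _ (v + w) Cb; have := (svalP b).1.1 v w.
        by have := ab w; lra.
      + have := i_le _ (v + w) Ca; have := (svalP a).1.1 v w.
        by have := ba v; lra.
    - rewrite -ler_pdivrMl//; apply: (@i_ge) => a Ca.
      rewrite ler_pdivrMl//; apply: le_trans (i_le _ _ Ca) _.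
      exact: (svalP a).1.2.
  have iq : below i q.
    by move=> v; apply: le_trans (i_le _ _ Ca0) _; exact: (svalP a0).2.
  exists (exist _ i (conj si iq)) => a Ca.
  by apply/asboolP => v; exact: i_le.
- case: m mmin => m [sm mq] mmin; exists m; split=> // m' sm' m'm.
  have m'q : below m' q by move=> v; exact: le_trans (m'm v) (mq v).
  by have /(_ _)/(congr1 sval) := mmin (exist _ m' (conj sm' m'q));
    apply; apply/asboolP.
Qed.

Lemma minimal_sublinear_linear q : sublinear q ->
  (forall q', sublinear q' -> below q' q -> q' = q) -> linear (q : V -> R^o).
Proof.
move=> sq qmin.
have qD u v : q (u + v) = q u + q v.
  apply/le_anti; rewrite sq.1/=.
  have tq : tilt q u = q.
    by apply: qmin; [exact: sublinear_tilt|move=> w; exact: tilt_le_self].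
  by have := tilt_le u v sq ler01; rewrite tq scale1r mul1r (addrC v); lra.
have qN v : q (- v) = - q v.
  by have := qD v (- v); rewrite subrr (sublinear0 sq); lra.
move=> t u v; rewrite qD; congr (_ + _).
have [t0|t0|->] := ltgtP t 0; last by rewrite !scale0r (sublinear0 sq).
- rewrite -[t]opprK scaleNr qN (sublinearZ _ sq) ?oppr_gt0// -mulNr//.
- exact: sublinearZ.
Qed.

Lemma linear_additive (f : V -> R) : linear (f : V -> R^o) ->
  [/\ f 0 = 0, {morph f : v / - v} & {morph f : u v / u + v}].
Proof.
move=> lf; have fD : {morph f : u v / u + v}.
  by move=> u v; have := lf 1 u v; rewrite !scale1r.
have f0 : f 0 = 0 by have := fD 0 0; rewrite addr0; lra.
by split=> // v; have := fD v (- v); rewrite subrr f0; lra.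
Qed.

(** Hahn-Banach.  A minimal sublinear function below the tilt of q at u is
    linear, and its value at - u is at most - q u. *)
Theorem norming_functional q u : sublinear q ->
  exists f : V -> R, [/\ linear (f : V -> R^o), below f q & f u = q u].
Proof.
move=> sq.
have [f [sf ft fmin]] := minimal_sublinear (sublinear_tilt u sq).
have lf := minimal_sublinear_linear sf fmin.
have fq v : f v <= q v by apply: le_trans (ft v) _; exact: tilt_le_self.
exists f; split=> //; apply/le_anti; rewrite fq/=.
have := tilt_le u (- u) sq ler01.
rewrite scale1r addNr (sublinear0 sq) mul1r.
by have := sublinearN (- u) sf; rewrite opprK; have := ft (- u); lra.
Qed.

End Sublinear.

(** * Uniform boundedness *)

(** Gliding hump.  If the p i were unbounded on every ball, one could choose
    u_0, u_1, ... in balls of rapidly decreasing radii and indices i_n such that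
    p i_n (u_0 + ... + u_n) > n while everything chosen later changes p i_n by
    at most 1; then the family would be unbounded at the sum of the series.
    The balls B are abstract so that the statement applies to a Banach space
    as well as to the bounded functionals inside the group of all functions,
    where only the elements of some ball count as vectors. *)
Lemma uniform_boundedness (R : realType) (V : zmodType) (I : Type)
    (B : R -> V -> Prop) (p : I -> V -> R) :
  B 0 0 ->
  (forall r s u v, B r u -> B s v -> B (r + s) (u + v)) ->
  (forall (rho : nat -> R) (u : nat -> V),
     (forall n, 0 < rho n) -> (forall n, rho n.+1 <= rho n / 2) ->
     (forall n, B (rho n) (u n)) ->
     exists v, forall n, B (2 * rho n) (v - \sum_(i < n) u i)) ->
  (forall i u v, p i (u + v) <= p i u + p i v) ->
  (forall i v, p i (- v) = p i v) ->
  (forall i, exists2 d, 0 < d & forall r v, r <= d -> B r v -> p i v <= 1) ->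
  (forall r v, B r v -> exists C, forall i, p i v <= C) ->
  exists2 rho, 0 < rho & exists C, forall i v, B rho v -> p i v <= C.
Proof.
move=> B0 BD Bcomplete pD pN pcont pbnd; apply: contrapT => unbounded.
have large rho C : 0 < rho -> exists i v, B rho v /\ C < p i v.
  move=> rho0; apply: contrapT => nex; apply: unbounded; exists rho => //.
  exists C => i v Bv; rewrite leNgt; apply/negP => pv.
  by apply: nex; exists i, v.
have [i0 _] := large 1 0 ltr01.
(* A state is a step number, the current partial sum and the next radius. *)
pose good (s : V * R) := (exists r, B r s.1) /\ 0 < s.2.
have step (s : nat * (V * R)) : exists y : V * I * R, good s.2 ->
    [/\ B s.2.2 y.1.1, s.1%:R < p y.1.2 (s.2.1 + y.1.1), 0 < y.2,
        y.2 <= s.2.2 / 2 & forall w, B (2 * y.2) w -> p y.1.2 w <= 1].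
  case: s => n [x rho] /=.
  have [[[r /= Bx] /= rho0]|bad] := pselect (good (x, rho)); last first.
    by exists (0, i0, 0).
  have [C xC] := pbnd _ _ Bx.
  have [i [v [Bv pv]]] := large rho (n%:R + C) rho0.
  have [d d0 pd] := pcont i.
  exists (v, i, Num.min (rho / 2) (d / 2)) => _ /=; split=> //.
  - have := pD i (x + v) (- x); rewrite addrC addKr pN.
    by have := xC i; lra.
  - by rewrite lt_min; apply/andP; split; lra.
  - by rewrite ge_min lexx.
  - move=> w; apply: pd.
    by rewrite mulrC -ler_pdivlMr// ge_min lexx orbT.
have {large} [f fP] := choice step.
pose st := fix st n : V * R := if n is m.+1 then
  ((st m).1 + (f (m, st m)).1.1, (f (m, st m)).2) else (0, 1).
pose u n := (f (n, st n)).1.1; pose i n := (f (n, st n)).1.2.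
pose rho n := (st n).2.
have st_good n : good (st n).
  elim: n => [|n IHn] /=; first by split; [exists 0|].
  have [Bu _ rho0 _ _] := fP (n, st n) IHn; split=> //=.
  by have [r Br] := IHn.1; eexists; exact: BD Br Bu.
have {}fP n := fP (n, st n) (st_good n).
have partial n : (st n).1 = \sum_(i < n) u i.
  by elim: n => [|n IHn]; rewrite ?big_ord0// big_ord_recr /= -IHn.
have [v vP] := Bcomplete rho u (fun n => (st_good n).2)
  (fun n => let: And5 _ _ _ h _ := fP n in h)
  (fun n => let: And5 h _ _ _ _ := fP n in h).
have [C vC] : exists C, forall i, p i v <= C.
  by have := vP 0%N; rewrite big_ord0 subr0; exact: pbnd.
have [n ltn] : exists n : nat, C + 1 < n%:R.
  by exists (Num.bound (C + 1)); exact: unstable.ltr_bound.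
have [_ /= pn _ _ /(_ _ (vP n.+1))] := fP n.
have -> : v - \sum_(j < n.+1) u j = - ((st n.+1).1 - v) by rewrite partial opprB.
rewrite pN => tail; have := pD (i n) ((st n.+1).1 - v) v.
by rewrite subrK; move: pn tail (vC (i n)); rewrite /= -/(u n) -/(i n); lra.
Qed.

(** * Real and complex scalars *)

Section Scalars.
Context (R : realType) (k : scalar_kind).
Local Notation K := (scalars R k).

Definition of_real : R -> K :=
  match k return R -> scalars R k with
  | RealScalars => id
  | ComplexScalars => fun a => a%:C%C
  end.

Lemma of_realD a b : of_real (a + b) = of_real a + of_real b.
Proof. by rewrite /of_real; case: k => //=; rewrite rmorphD. Qed.

Lemma of_realN a : of_real (- a) = - of_real a.
Proof. by rewrite /of_real; case: k => //=; rewrite rmorphN. Qed.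

Lemma of_realM a b : of_real (a * b) = of_real a * of_real b.
Proof. by rewrite /of_real; case: k => //=; rewrite rmorphM. Qed.

Lemma of_real0 : of_real 0 = 0.
Proof. by rewrite /of_real; case: k. Qed.

Lemma of_real1 : of_real 1 = 1.
Proof. by rewrite /of_real; case: k. Qed.

Lemma of_real_le a b : (of_real a <= of_real b) = (a <= b).
Proof. by rewrite /of_real; case: k => //=; rewrite lecR. Qed.

Lemma of_real_lt a b : (of_real a < of_real b) = (a < b).
Proof. by rewrite /of_real; case: k => //=; rewrite ltcR. Qed.

Lemma norm_of_real a : `|of_real a| = of_real `|a|.
Proof. by rewrite /of_real; case: k => //=; rewrite normc_def /= expr0n addr0 sqrtr_sqr. Qed.

Lemma of_realK : cancel of_real (@real_part R k).
Proof. by rewrite /of_real /real_part; case: k. Qed.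

Lemma ge0_of_real (a : K) : 0 <= a -> a = of_real (real_part a).
Proof.
rewrite /of_real /real_part; case: k a => //= -[x y].
by rewrite lecE /= => /andP[/eqP -> _].
Qed.

Lemma normE (V : normedModType K) (v : V) : `|v| = of_real (rnorm v).
Proof. exact: ge0_of_real. Qed.

Section Norm.
Context (V : normedModType K).
Implicit Types u v : V.

Lemma rnorm_ge0 v : 0 <= rnorm v.
Proof. by rewrite -of_real_le -normE of_real0 normr_ge0. Qed.

Lemma rnormD u v : rnorm (u + v) <= rnorm u + rnorm v.
Proof. by rewrite -of_real_le of_realD -!normE ler_normD. Qed.

Lemma rnormN v : rnorm (- v) = rnorm v.
Proof. by rewrite /rnorm normrN. Qed.

Lemma rnormZ (a : K) v : rnorm (a *: v) = rnorm (a : K^o) * rnorm v.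
Proof. by rewrite -[RHS]of_realK of_realM -!normE /rnorm normrZ. Qed.

Lemma rnorm_of_real a : rnorm (of_real a : K^o) = `|a|.
Proof. by rewrite -[RHS]of_realK -norm_of_real. Qed.

Lemma rnormZr a v : rnorm (of_real a *: v) = `|a| * rnorm v.
Proof. by rewrite rnormZ rnorm_of_real. Qed.

Lemma rnorm0 : rnorm (0 : V) = 0.
Proof. by rewrite /rnorm normr0 /real_part; case: k. Qed.

End Norm.

(** Restriction of the scalars to the real numbers: the real Hahn-Banach
    theorem and a single notion of functional then serve both fields. *)
Definition realified (V : lmodType K) : Type := V.
HB.instance Definition _ (V : lmodType K) := GRing.Zmodule.on (realified V).

Definition real_scale (V : lmodType K) (t : R) (v : realified V) : realified V :=
  of_real t *: (v : V).

Fact real_scaleA (V : lmodType K) a b (v : realified V) :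
  real_scale a (real_scale b v) = real_scale (a * b) v.
Proof. by rewrite /real_scale of_realM; exact: scalerA. Qed.
Fact real_scale1 (V : lmodType K) : left_id 1 (@real_scale V).
Proof. by move=> v; rewrite /real_scale of_real1; exact: scale1r. Qed.
Fact real_scaleDr (V : lmodType K) : right_distributive (@real_scale V) +%R.
Proof. by move=> t u v; exact: scalerDr. Qed.
Fact real_scaleDl (V : lmodType K) (v : realified V) :
  {morph (@real_scale V)^~ v : a b / a + b}.
Proof. by move=> a b; rewrite /real_scale of_realD; exact: scalerDl. Qed.
HB.instance Definition _ (V : lmodType K) :=
  GRing.Zmodule_isLmodule.Build R (realified V)
    (@real_scaleA V) (@real_scale1 V) (@real_scaleDr V) (@real_scaleDl V).

Lemma realified_scaleE (V : lmodType K) (t : R) (v : V) :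
  t *: (v : realified V) = of_real t *: v.
Proof. by []. Qed.
End Scalars.

(** * Bounded functionals and weak summability *)

(** A real-linear functional is the real part of a linear one, namely of
    f v - i f (i v) when the scalars are complex; so weak summability, a
    statement about linear functionals, controls the real-linear ones. *)
Lemma real_part_functional (R : realType) (k : scalar_kind)
    (V : normedModType (scalars R k)) (f : realified V -> R) (c : R) :
  linear (f : realified V -> R^o) -> (forall v, `|f v| <= c * rnorm v) ->
  exists2 phi : {linear V -> (scalars R k)^o},
    (dual_norm phi < +oo)%E & forall v, `|f v| <= rnorm (phi v).
Proof.
case: k V f => V f lf fc.
  pose phi : {linear V -> R^o} :=
    HB.pack (f : V -> R^o) (GRing.isLinear.Build R V R^o _ _ lf).
  exists phi => [|v]; last exact: lexx.
  apply: le_lt_trans (ltry `|c|).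
  apply: ge_ereal_sup => _ [v /= v1 <-]; rewrite lee_fin.
  apply: le_trans (fc v) _; apply: le_trans (ler_wpM2r (rnorm_ge0 _) (ler_norm c)) _.
  by rewrite ler_piMr.
have fE (x : R) (u v : V) : f (x%:C%C *: u + v) = x * f u + f v by exact: lf.
pose g (v : V) : R[i] := (f v +i* - f ('i%C *: v))%C.
have lg : linear (g : V -> R[i]^o).
  move=> [x y] u v.
  have iu : (x +i* y)%C *: u = x%:C%C *: u + y%:C%C *: ('i%C *: u).
    by rewrite scalerA -scalerDl; congr (_ *: _); simpc.
  have iiu : 'i%C *: ((x +i* y)%C *: u) = x%:C%C *: ('i%C *: u) + (- y)%:C%C *: u.
    by rewrite !scalerA -scalerDl; congr (_ *: _); simpc.
  rewrite /g scalerDr iiu iu -!addrA !fE.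
  apply/eqP; rewrite eq_complex /=; apply/andP; split; apply/eqP; ring.
pose phi : {linear V -> R[i]^o} :=
  HB.pack g (GRing.isLinear.Build R[i] V R[i]^o _ _ lg).
exists phi => [|v]; last first.
  by have := normc_ge_Re (g v); rewrite /rnorm !normc_def lecR.
have i1 (v : V) : @rnorm R ComplexScalars V ('i%C *: v) = rnorm v.
  rewrite [LHS]rnormZ /rnorm normc_def /= expr0n expr1n add0r sqrtr1 mul1r //.
apply: le_lt_trans (ltry (2 * `|c|)).
apply: ge_ereal_sup => _ [v v1 <-]; rewrite lee_fin.
have fc1 (w : V) : rnorm w <= 1 -> `|f w| <= `|c|.
  move=> w1; apply: le_trans (fc w) _.
  apply: le_trans (ler_wpM2r (rnorm_ge0 _) (ler_norm c)) _.
  by rewrite ler_piMr.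
have -> : @rnorm R ComplexScalars R[i]^o (phi v) = Num.sqrt (f v ^+ 2 + f ('i%C *: v) ^+ 2).
  by rewrite /rnorm normc_def /= sqrrN.
have := fc1 _ v1; have := fc1 ('i%C *: v); rewrite i1 => /(_ v1).
set x := f v; set y := f _ => yc xc.
rewrite -(ger0_norm (_ : 0 <= 2 * `|c|)) ?mulr_ge0// -sqrtr_sqr ler_wsqrtr//.
rewrite -(real_normK (num_real x)) -(real_normK (num_real y)).
by have := normr_ge0 x; have := normr_ge0 y; nra.
Qed.

Lemma halving_small (R : realType) (rho : nat -> R) (e : R) :
  (forall n, 0 <= rho n) -> (forall n, rho n.+1 <= rho n / 2) -> 0 < e ->
  exists n, rho n < e.
Proof.
move=> rho0 half e0.
have bnd n : rho n * n.+1%:R <= rho 0%N.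
  elim: n => [|n]; first by rewrite mulr1.
  apply: le_trans; have := ler_wpM2r (ler0n R n.+2) (half n).
  move/le_trans; apply; rewrite -mulrA ler_wpM2l//.
  by rewrite -[n.+2]addn2 -[n.+1]addn1 !natrD; have := ler0n R n; lra.
exists (Num.bound (rho 0%N / e)); set n := Num.bound _.
have : rho 0%N / e < n%:R by exact: unstable.ltr_bound.
rewrite ltr_pdivrMr// => ltn; rewrite ltNge; apply/negP => en.
have := bnd n; have := ler_wpM2r (ler0n R n.+1) en.
by rewrite -[n.+1]addn1 natrD; nra.
Qed.

Lemma halving_le0 (R : realType) (rho : nat -> R) (a c : R) :
  (forall n, 0 <= rho n) -> (forall n, rho n.+1 <= rho n / 2) ->
  0 <= c -> (forall n, a <= rho n * c) -> a <= 0.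
Proof.
move=> rho0 half c0 ac; rewrite leNgt; apply/negP => a0.
have c1 : 0 < c + 1 by lra.
have [n] := halving_small rho0 half (divr_gt0 a0 c1).
rewrite ltr_pdivlMr//; have := ac n; have := rho0 n; nra.
Qed.

(** Completeness in the form used by [uniform_boundedness]: the halving of the
    bounds makes the tail of the series at most twice its first bound. *)
Lemma series_tail (R : realType) (k : scalar_kind)
    (V : completeNormedModType (scalars R k)) (rho : nat -> R) (u : nat -> V) :
  (forall n, rho n.+1 <= rho n / 2) -> (forall n, rnorm (u n) <= rho n) ->
  exists v, forall n, rnorm (v - \sum_(i < n) u i) <= 2 * rho n.
Proof.
move=> half urho; pose S n := \sum_(i < n) u i.
have rho0 n : 0 <= rho n by exact: le_trans (rnorm_ge0 _) (urho n).
have SB n d : rnorm (S (n + d)%N - S n) <= 2 * rho n - 2 * rho (n + d)%N.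
  elim: d => [|d IHd]; first by rewrite addn0 !subrr rnorm0.
  rewrite addnS /S big_ord_recr /= addrAC; apply: le_trans (rnormD _ _) _.
  by move: IHd (urho (n + d)%N) (half (n + d)%N); rewrite /S; lra.
have SB2 n m : (n <= m)%N -> rnorm (S m - S n) <= 2 * rho n.
  by move=> /subnKC <-; have := SB n (m - n)%N; have := rho0 (n + (m - n))%N; lra.
have pos_real (e : scalars R k) : 0 < e -> 0 < real_part e /\ e = of_real k (real_part e).
  move=> e0; have eE := ge0_of_real (ltW e0); split=> //.
  by rewrite -(@of_real_lt _ k) of_real0 -eE.
have rnorm_lt (w : V) (e : R) : rnorm w < e -> `|w| < of_real k e.
  by rewrite normE of_real_lt.
have Scvg : cvg (S @ \oo)%classic.
  apply/cauchy_cvgP/cauchyP => eps /pos_real[]; set e := real_part eps => e0 ->.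
  have [n ne] := halving_small rho0 half (divr_gt0 e0 (ltr0n R 2)).
  exists (S n); exists n => // m /= nm; rewrite -ball_normE /=.
  by rewrite distrC; apply: rnorm_lt; apply: le_lt_trans (SB2 _ _ nm) _; lra.
exists (lim (S @ \oo)%classic) => n; apply/ler_addgt0Pr => e e0.
have /cvgrPdist_lt/(_ (of_real k e)) := Scvg.
rewrite -(of_real0 R k) of_real_lt => /(_ e0) [m _ /(_ (maxn m n))].
rewrite /= leq_maxl => /(_ isT); rewrite normE of_real_lt => near_lim.
rewrite -(subrKA (S (maxn m n))); apply: le_trans (rnormD _ _) _.
by have := SB2 n _ (leq_maxr m n); rewrite -/(S n); lra.
Qed.

Section Functionals.
Context (R : realType) (k : scalar_kind).
Local Notation K := (scalars R k).

(** A ball of the real dual, as a set of plain functions: the functions form a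
    group, which is the setting of [uniform_boundedness]. *)
Definition dual_ball (V : normedModType K) (c : R) (f : realified V -> R) : Prop :=
  linear (f : realified V -> R^o) /\ forall v, `|f v| <= c * rnorm v.

Lemma dual_complete (V : normedModType K) (rho : nat -> R)
    (u : nat -> realified V -> R) :
  (forall n, 0 < rho n) -> (forall n, rho n.+1 <= rho n / 2) ->
  (forall n, dual_ball (rho n) (u n)) ->
  exists f, forall n, dual_ball (2 * rho n) (f - \sum_(i < n) u i).
Proof.
move=> rho_gt0 half ball_u; have rho0 n := ltW (rho_gt0 n).
have pointwise (v : realified V) : exists y : R, forall n,
    `|y - \sum_(i < n) u i v| <= 2 * (rho n * rnorm (v : V)).
  have [|n|y yP] := @series_tail R RealScalars R^o
      (fun n => rho n * rnorm (v : V)) (fun n => u n v).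
  - by move=> n; have := half n; have := @rnorm_ge0 _ _ V v; nra.
  - exact: (ball_u n).2.
  - by exists y.
have [f fP] := choice pointwise.
pose S n v := \sum_(i < n) u i v.
have Slin n : linear (S n : realified V -> R^o).
  move=> a v w; rewrite /S scaler_sumr -big_split; apply: eq_bigr => i _.
  exact: (ball_u i).1.
have flin : linear (f : realified V -> R^o).
  move=> a v w; apply/eqP; rewrite -subr_eq0 -normr_le0.
  set d := (X in `|X|).
  apply: (@halving_le0 _ rho _ (2 * (rnorm (a *: v + w : V) +
    `|a| * rnorm (v : V) + rnorm (w : V)))) => //.
    by rewrite mulr_ge0// !addr_ge0// ?mulr_ge0// rnorm_ge0.
  move=> n.
  have -> : d = (f (a *: v + w) - S n (a *: v + w))
      - a * (f v - S n v) - (f w - S n w).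
    have : S n (a *: v + w) = a * S n v + S n w by exact: Slin.
    by rewrite /d => -> ; rewrite /GRing.scale /=; ring.
  apply: le_trans (ler_normB _ _) _.
  have := fP w n; have := fP (a *: v + w) n; have := fP v n.
  have := ler_normB (f (a *: v + w) - S n (a *: v + w)) (a * (f v - S n v)).
  have := normr_ge0 a; rewrite normrM -/(S n _) -/(S n _) -/(S n _).
  by nra.
exists f => n; have fE v : (f - \sum_(i < n) u i) v = f v - S n v.
  by rewrite fct_sumE.
split=> [a v w|v]; last by rewrite fE -mulrA; exact: fP.
by rewrite !fE flin Slin scalerBr opprD addrACA.
Qed.

Lemma exists_norming (V : normedModType K) (v : V) :
  exists2 f, dual_ball 1 f & f v = rnorm v.
Proof.
have srnorm : sublinear (@rnorm R k V : realified V -> R).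
  split=> [u w|t w t0]; first exact: rnormD.
  by rewrite realified_scaleE rnormZr gtr0_norm.
have [f [lf fle fv]] := norming_functional (v : realified V) srnorm.
exists f => //; split=> // w; rewrite mul1r ler_norml fle andbT.
have [_ fN _] := linear_additive lf.
by have := fle (- w); rewrite fN lerNl rnormN.
Qed.

End Functionals.
Lemma lp1P (R : realType) (k : scalar_kind) (V : normedModType (scalars R k))
    (u : nat -> V) :
  lp 1 u <-> exists C : R, forall m, \sum_(j < m) rnorm (u j) <= C.
Proof.
pose a j := (rnorm (u j))%:E.
have a0 j : (0 <= a j)%E by rewrite lee_fin rnorm_ge0.
have -> : lp 1 u = (\sum_(0 <= j <oo) a j < +oo)%E.
  rewrite /lp /lp_norm /= invr1 poweRe1.
    by under eq_eseriesr do rewrite powRr1 ?rnorm_ge0//.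
  by apply: nneseries_ge0 => j _ _; rewrite lee_fin powR_ge0.
have partial m : (\sum_(0 <= j < m) a j)%E = (\sum_(j < m) rnorm (u j))%:E.
  by rewrite sumEFin big_mkord.
split=> [afin|[C uC]].
- exists (fine (\sum_(0 <= j <oo) a j)%E) => m.
  rewrite -lee_fin fineK; last first.
    by rewrite ge0_fin_numE// nneseries_ge0.
  by rewrite -partial; exact: nneseries_lim_ge.
- apply: le_lt_trans (ltry C); apply: lime_le; first exact: is_cvg_nneseries.
  by near=> m; rewrite partial lee_fin.
Unshelve. all: by end_near. Qed.

Definition signed_sum (V : zmodType) (x : nat -> V) (e : nat -> bool) m : V :=
  \sum_(l < m) (if e l then - x l else x l).

(** Each functional f is bounded on the signed sums by the sum of the |f (x_l)|.
    Uniform boundedness makes these bounds uniform over a ball of functionals,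
    and a multiple of the functional norming the signed sum lies in that ball. *)
Lemma weak_l1_signed_sum_bounded (R : realType) (k : scalar_kind)
    (V : normedModType (scalars R k)) (x : nat -> V) :
  weak_lp 1 x -> exists C : R, forall e m, rnorm (signed_sum x e m) <= C.
Proof.
move=> wx.
have [|||m f g|m f|m|r f [lf fr]|rho rho0 [C pC]] :=
    @uniform_boundedness R (realified V -> R) nat (@dual_ball R k V)
      (fun m f => \sum_(l < m) `|f (x l)|).
- split=> [a u v|v]; last by rewrite normr0 mul0r.
  by rewrite /= scaler0 addr0.
- move=> r s f g [lf fr] [lg gs]; split=> [a u v|v].
    rewrite -[LHS]/(f (a *: u + v) + g (a *: u + v)) lf lg addrACA -scalerDr //.
  by apply: le_trans (ler_normD _ _) _; rewrite mulrDl lerD.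
- exact: dual_complete.
- by rewrite -big_split; apply: ler_sum => l _; exact: ler_normD.
- by apply: eq_bigr => l _; exact: normrN.
- pose c : R := \sum_(l < m) rnorm (x l).
  have c0 : 0 <= c by apply: sumr_ge0 => l _; exact: rnorm_ge0.
  exists (c + 1)^-1 => [|r f rd [_ fr]]; first by rewrite invr_gt0; lra.
  apply: (@le_trans _ _ (r * c)).
    by rewrite /c mulr_sumr; apply: ler_sum => l _; exact: fr.
  have : (c + 1)^-1 * (c + 1) = 1 by rewrite mulVf//; lra.
  have : 0 < (c + 1)^-1 by rewrite invr_gt0; lra.
  by nra.
- have [phi phifin fphi] := real_part_functional lf fr.
  have [C phiC] := (lp1P _).1 (wx phi phifin).
  by exists C => m; apply: le_trans (phiC m); apply: ler_sum => l _; exact: fphi.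
exists (rho^-1 * C) => e m.
have [f [lf f1] fz] := exists_norming (signed_sum x e m).
rewrite ler_pdivlMl// -fz.
have [f0 fN fD] := linear_additive lf.
have scE v : `|(rho *: f) v| = rho * `|f v|.
  by rewrite -[(rho *: f) v]/(rho * f v) normrM gtr0_norm.
apply: le_trans (pC m (rho *: f) _); last first.
  split=> [a u v|v].
    rewrite -[LHS]/(rho *: (f (a *: u + v) : R^o)) lf scalerDr !scalerA.
    by rewrite mulrC -scalerA.
  by rewrite scE ler_pM2l//; have := f1 v; rewrite mul1r.
rewrite /signed_sum (big_morph f fD f0) mulr_sumr; apply: ler_sum => l _.
rewrite scE ler_pM2l//.
by case: ifP => _; [rewrite [f _]fN -normrN|]; exact: ler_norm.
Qed.

(** * Averaging over signs *)

(** Reversing all signs of a signed sum but the j-th one and adding the result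
    to it leaves twice x_j, up to sign.  Hence h j (x j) is at most the mean of
    the values of h j at all signed sums; as these do not depend on j, the
    bounds can be added before the mean is taken. *)
Lemma sum_diagonal_le (R : realType) (V : zmodType) (h : nat -> V -> R)
    (x : nat -> V) (m : nat) (C : R) :
  (forall j u v, h j (u + v) <= h j u + h j v) ->
  (forall j v, h j (- v) = h j v) ->
  (forall j v, h j (v + v) = h j v + h j v) ->
  (forall e, \sum_(j < m) h j (signed_sum x e m) <= C) ->
  \sum_(j < m) h j (x j) <= C.
Proof.
move=> hD hN h2 hC.
pose S := {ffun 'I_m -> bool}.
pose z (e : S) := \sum_(l < m) (if e l then - x l else x l).
have zC e : \sum_(j < m) h j (z e) <= C.
  have -> : z e = signed_sum x (fun l => if insub l is Some i then e i else false) m.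
    by apply: eq_bigr => l _; rewrite valK.
  exact: hC.
pose flip (j : 'I_m) (e : S) : S := [ffun l => (l != j) (+) e l].
have flipK j : involutive (flip j).
  by move=> e; apply/ffunP => l; rewrite !ffunE addbA addbb.
have flip_add (j : 'I_m) e : h j (x j) + h j (x j) <= h j (z e) + h j (z (flip j e)).
  apply: le_trans (hD j _ _).
  have -> : z e + z (flip j e) = if e j then - (x j + x j) else x j + x j.
    rewrite -big_split (bigD1 j)//= big1 ?addr0 => [|l lj].
      by rewrite ffunE eqxx /=; case: (e j); rewrite ?opprD.
    by rewrite ffunE lj; case: (e l); rewrite /= ?addNr ?subrr.
  by rewrite -h2; case: (e j); rewrite ?hN.
have avg (j : 'I_m) : h j (x j) * #|S|%:R <= \sum_e h j (z e).
  have : \sum_(e : S) (h j (x j) + h j (x j)) <=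
         \sum_(e : S) (h j (z e) + h j (z (flip j e))).
    by apply: ler_sum => e _; exact: flip_add.
  have reflip : \sum_e h j (z (flip j e)) = \sum_e h j (z e).
    by rewrite [RHS](reindex_inj (inv_inj (flipK j))).
  rewrite !big_split/= reflip.
  by rewrite sumr_const -[_ *+ _]mulr_natr; lra.
have S0 : 0 < #|S|%:R :> R.
  by rewrite ltr0n; apply/card_gt0P; exists [ffun=> false].
rewrite -(ler_pM2r S0) mulr_suml.
apply: le_trans (_ : \sum_(j < m) \sum_e h j (z e) <= _).
  by apply: ler_sum => j _; exact: avg.
rewrite exchange_big/= mulr_natr -sumr_const.
by apply: ler_sum => e _; exact: zC.
Qed.

(** The step that unfreezes one variable.  By uniform boundedness the sum of
    the h j (v) is at most a multiple of the norm of v; at signed sums of x this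
    is bounded, and averaging over the signs recovers the h j (x j). *)
Lemma diagonal_summable (R : realType) (k : scalar_kind)
    (V : completeNormedModType (scalars R k)) (h : nat -> V -> R) (x : nat -> V) :
  (forall j u v, h j (u + v) <= h j u + h j v) ->
  (forall j a v, h j (of_real k a *: v) = `|a| * h j v) ->
  (forall j, exists c, forall v, rnorm v <= 1 -> h j v <= c) ->
  (forall v, exists C, forall m, \sum_(j < m) h j v <= C) ->
  weak_lp 1 x ->
  exists C, forall m, \sum_(j < m) h j (x j) <= C.
Proof.
move=> hD hZ hbnd hsum wx.
have hN j v : h j (- v) = h j v.
  have := hZ j (-1) v; rewrite normrN1 mul1r => <-; congr (h j _).
  by rewrite of_realN of_real1 scaleN1r.
have h2 j v : h j (v + v) = h j v + h j v.
  have := hZ j 2 v; rewrite of_realD of_real1 scalerDl scale1r => ->.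
  by rewrite ger0_norm// mulrDl mul1r.
have h0 j : h j 0 = 0.
  by have := h2 j 0; rewrite addr0; lra.
have hge0 j v : 0 <= h j v.
  by have := hD j v (- v); rewrite subrr h0 hN; lra.
pose p m v := \sum_(j < m) h j v.
have pZ m a v : p m (of_real k a *: v) = `|a| * p m v.
  by rewrite /p mulr_sumr; apply: eq_bigr => j _; exact: hZ.
have [|||m u v|m v|m|r v _|rho rho0 [C pC]] :=
    @uniform_boundedness R V nat (fun r v => rnorm v <= r) p.
- by rewrite rnorm0.
- by move=> r s u v ur vs; apply: le_trans (rnormD _ _) _; exact: lerD.
- by move=> r u _; exact: series_tail.
- by rewrite -big_split; apply: ler_sum => j _; exact: hD.
- by apply: eq_bigr => j _; exact: hN.
- have [c hc] := choice hbnd.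
  pose c' : R := 1 + \sum_(j < m) `|c j|.
  have c'0 : 0 < c' by rewrite ltr_pwDl// sumr_ge0.
  exists c'^-1 => [|r v rd vr]; first by rewrite invr_gt0.
  have pc' : c' * p m v = p m (of_real k c' *: v) by rewrite pZ gtr0_norm.
  rewrite -(ler_pM2l c'0) mulr1 pc' ler_wpDl//; apply: ler_sum => j _.
  apply: le_trans (ler_norm _); apply: hc.
  rewrite rnormZr (gtr0_norm c'0) -ler_pdivlMl// mulr1.
  exact: le_trans vr rd.
- exact: hsum.
have [M xM] := weak_l1_signed_sum_bounded wx.
have M1 : 0 < M + 1.
  by have := xM (fun=> false) 0%N; have := rnorm_ge0 (signed_sum x (fun=> false) 0%N); lra.
pose t := rho / (M + 1); have t0 : 0 < t by rewrite divr_gt0.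
exists (t^-1 * C) => m; apply: (@sum_diagonal_le _ V h x) => // e.
rewrite -/(p m _); set z := signed_sum x e m.
have pt : t * p m z = p m (of_real k t *: z) by rewrite pZ gtr0_norm.
rewrite ler_pdivlMl// pt; apply: pC.
rewrite rnormZr gtr0_norm// /t mulrAC ler_pdivrMr// ler_pM2l//.
by have := xM e m; rewrite -/z; lra.
Qed.

(** * Multilinear maps *)

Section MultilinearMaps.
Context (R : realType) (k : scalar_kind) (n : nat).
Local Notation K := (scalars R k).
Context (E : 'I_n -> completeNormedModType K) (F : completeNormedModType K).
Implicit Types (A : (forall i, E i) -> F) (x : forall i, E i).

Lemma dfwith_eq (T : 'I_n -> Type) (x y : forall i, T i) (i : 'I_n) :
  (forall l, l != i -> y l = x l) -> dfwith x i (y i) = y.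
Proof.
move=> yx; apply: functional_extensionality_dep => l.
by case: dfwithP => // j ij; rewrite yx// eq_sym.
Qed.

Lemma multilinearD A x i (u v : E i) : multilinear A ->
  A (dfwith x i (u + v)) = A (dfwith x i u) + A (dfwith x i v).
Proof. by move=> mA; have := mA x i 1 u v; rewrite !scale1r. Qed.

Lemma multilinearZ A x i a (u : E i) : multilinear A ->
  A (dfwith x i (a *: u)) = a *: A (dfwith x i u).
Proof.
move=> mA; have A0 : A (dfwith x i 0) = 0.
  have /eqP := multilinearD x (0 : E i) 0 mA.
  by rewrite addr0 -subr_eq subrr => /eqP.
by have := mA x i a u 0; rewrite A0 !addr0.
Qed.

Lemma multilinear_scale A x (c : 'I_n -> K) : multilinear A ->
  A (fun i => c i *: x i) = (\prod_i c i) *: A x.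
Proof.
move=> mA.
pose w t i : E i := if (i < t)%N then c i *: x i else x i.
have wE t : (t <= n)%N -> A (w t) = (\prod_(i < n | (i < t)%N) c i) *: A x.
  elim: t => [_|t IHt tn]; first by rewrite big_pred0// scale1r.
  pose i := Ordinal tn.
  have w1 : w t.+1 = dfwith (w t) i (c i *: x i).
    have -> : c i *: x i = w t.+1 i by rewrite /w ltnSn.
    rewrite dfwith_eq// => l li; rewrite /w ltnS leq_eqVlt.
    by rewrite (_ : (l == t :> nat) = false)//; apply/negbTE.
  have w0 : dfwith (w t) i (x i) = w t.
    have -> : x i = w t i by rewrite /w ltnn.
    by rewrite dfwith_eq.
  rewrite w1 multilinearZ// w0 IHt ?(ltnW tn)// scalerA; congr (_ *: _).
  rewrite [RHS](bigD1 i)//=; congr (_ * _); apply: eq_bigl => l.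
  by rewrite ltnS -val_eqE /= ltn_neqAle andbC.
have -> : (fun i => c i *: x i) = w n.
  by apply: functional_extensionality_dep => i; rewrite /w ltn_ord.
by rewrite wE//; congr (_ *: _); apply: eq_bigl => i; rewrite ltn_ord.
Qed.

(** Boundedness is given on the product of the unit balls only; homogeneity in
    each variable transports it to balls of any radii. *)
Lemma bounded_multilinear_polydisc A (r : 'I_n -> R) : bounded_multilinear A ->
  (forall i, 0 < r i) ->
  exists c, forall x, (forall i, rnorm (x i) <= r i) -> rnorm (A x) <= c.
Proof.
move=> [mA]; rewrite /mlnorm; set s := ereal_sup _ => sfin r0.
exists ((\prod_i r i) * fine s) => x xr.
pose y i := of_real k (r i)^-1 *: x i.
have y1 i : rnorm (y i) <= 1.
  by rewrite rnormZr gtr0_norm ?invr_gt0// ler_pdivrMl// mulr1.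
have xE : x = (fun i => of_real k (r i) *: y i).
  apply: functional_extensionality_dep => i.
  by rewrite scalerA -of_realM mulfV ?gt_eqF// of_real1 scale1r.
have Ay : ((rnorm (A y))%:E <= s)%E by apply: ereal_sup_ubound; exists y.
have sE : s \is a fin_num.
  by rewrite ge0_fin_numE//; apply: le_trans Ay; rewrite lee_fin rnorm_ge0.
rewrite xE multilinear_scale// -(big_morph _ (@of_realM R k) (of_real1 R k)).
rewrite rnormZr ger0_norm ?prodr_ge0// => [|i _]; last exact: ltW.
rewrite ler_wpM2l ?prodr_ge0// => [i _|]; first exact: ltW.
by rewrite -lee_fin fineK.
Qed.

End MultilinearMaps.

(** * Unfreezing the variables one by one *)

(* n = r + s, so 1 <= r < n and s = n - r read 1 <= r and 1 <= s *)
Theorem theorem2 (R : realType) (k : scalar_kind) (r s : nat)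
    (hr : (1 <= r)%N) (hs : (1 <= s)%N)
    (E : 'I_(r + s) -> completeNormedModType (scalars R k))
    (F : completeNormedModType (scalars R k))
    (q : 'I_s -> R) (hq : forall j, 1 <= q j)
    (A : (forall l, E l) -> F) (hA : bounded_multilinear A)
    (hK : exists2 K : R, 0 < K &
      forall x : (forall i : 'I_r, E (lshift s i)),
        absolutely_summing (E := fun j => E (rshift r j)) 1 q (fix_first A x) /\
        (as_norm (E := fun j => E (rshift r j)) 1 q (fix_first A x)
           <= K%:E * mlnorm A * (\prod_(i < r) rnorm (x i))%:E)%E) :
  absolutely_summing 1 (ones_then q) A.
Proof.
move=> x wx; have mA := hA.1.
have wx1 i : weak_lp 1 (x (lshift s i)).
  by have := wx (lshift s i); rewrite /ones_then append_lshift.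
have wxq j : weak_lp (q j) (x (rshift r j)).
  by have := wx (rshift r j); rewrite /ones_then append_rshift.
(* The first t variables and the last s ones run along the sequences x,
   the other ones are frozen at z. *)
pose w t (z : forall l, E l) j l : E l :=
  if (l < t)%N || (r <= l)%N then x l j else z l.
have frozen t : (t <= r)%N ->
    forall z, exists C : R, forall m, \sum_(j < m) rnorm (A (w t z j)) <= C.
  elim: t => [_ z|t IHt tr z].
    (* With no variable replaced, this is the summability of the partial map. *)
    have [K _ /(_ (fun i => z (lshift s i)))[/(_ _ wxq)/lp1P[C AC] _]] := hK.
    exists C => m; apply: le_trans (AC m); apply: ler_sum => j _.
    rewrite le_eqVlt; apply/orP; left; apply/eqP; congr (rnorm (A _)).
    apply: functional_extensionality_dep => l.
    case: (split_ordP l) => i ->.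
      by rewrite append_lshift /w /= leqNgt ltn_ord.
    by rewrite append_rshift /w /= leq_addr.
  (* Replace the variable of index t: the seminorms of [diagonal_summable] are
     the norms of A as functions of this variable alone. *)
  pose i := lshift s (Ordinal tr).
  have wS j : w t.+1 z j = dfwith (w t z j) i (x i j).
    have -> : x i j = w t.+1 z j i by rewrite /w /= ltnSn.
    rewrite dfwith_eq// => l li; rewrite /w ltnS leq_eqVlt.
    by rewrite (_ : (l == t :> nat) = false)//; apply/negbTE.
  have wZ v j : dfwith (w t z j) i v = w t (dfwith z i v) j.
    have {1}-> : v = w t (dfwith z i v) j i.
      by rewrite /w /= ltnn leqNgt tr dfwithin.
    by rewrite dfwith_eq// => l li; rewrite /w dfwithout// eq_sym.
  have [|||||C hC] := @diagonal_summable R k (E i)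
    (fun j v => rnorm (A (dfwith (w t z j) i v))) (x i).
  - by move=> j u v; rewrite multilinearD// rnormD.
  - by move=> j a v; rewrite multilinearZ// rnormZr.
  - move=> j; pose rho l := 1 + rnorm (dfwith (w t z j) i 0 l).
    have [l|c Ac] := bounded_multilinear_polydisc (r := rho) hA.
      by rewrite ltr_pwDl// rnorm_ge0.
    (* At index i the radius is 1, the other entries are fixed vectors. *)
    exists c => v v1; apply: Ac => l; rewrite /rho.
    have [<-|il] := eqVneq i l; first by rewrite !dfwithin rnorm0 addr0.
    by rewrite !dfwithout// lerDr.
  - move=> v; have [C vC] := IHt (ltnW tr) (dfwith z i v); exists C => m.
    by under eq_bigr do rewrite wZ.
  - exact: wx1.
  by exists C => m; under eq_bigr do rewrite wS.
apply/lp1P; have [C AC] := frozen r (leqnn r) (fun=> 0); exists C => m.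
apply: le_trans (AC m); apply: ler_sum => j _.
rewrite le_eqVlt; apply/orP; left; apply/eqP; congr (rnorm (A _)).
by apply: functional_extensionality_dep => l; rewrite /w ltnNge orNb.
Qed.
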